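(* Let $(\mathbf d_n)_{n\ge1}$ be a family of degree sequences and $v_n\in[n]$. Assume, as $n\to\infty$, \[\sigma^2(\mathbf d_n)=o\Big(\frac{n}{(\log n)^3}\Big),\qquad \sigma^2(\mathbf d_n)=\omega(n^{-1}),\qquad \Delta(\mathbf d_n)=o\Big(\sqrt{\frac{n\sigma^2(\mathbf d_n)}{(\log n)^3}}\Big).\] Let $X$ and $U$ be independent, $U$ uniform on $[0,1]$ and $X$ standard Rayleigh distributed ($\mathbb P(X>x)=e^{-x^2/2}$, $x>0$). Then \[\Big(\frac{\mathfrak s_n(v_n)}{\sqrt{n/\sigma^2(\mathbf d_n)}},\ \frac{\mathfrak t_n(v_n)}{\sqrt{n/\sigma^2(\mathbf d_n)}}\Big)\xrightarrow{d}(X,UX).\]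
   Context: A degree sequence is $\mathbf d_n=(d_{n,1},\ldots,d_{n,n})\in\mathbb N_0^n$ with $\sum_j d_{n,j}=n$. For such a sequence let $\mathfrak F(\mathbf d_n)=\{f:[n]\to[n]: |f^{-1}(\{i\})|=d_{n,i}\ \forall i\in[n]\}$; $F$ denotes a uniform element of $\mathfrak F(\mathbf d_n)$. For $f:V\to V$ and $v\in V$, the six-length is $\mathfrak s_f(v)=\min\{k\in\mathbb N: f^{(k)}(v)\in\{f^{(j)}(v):0\le j\le k-1\}\}$ ($f^{(k)}$ the $k$-fold composition, $f^{(0)}=\mathrm{id}$), and the tail-length $\mathfrak t_f(v)$ is the unique integer with $0\le\mathfrak t_f(v)<\mathfrak s_f(v)$ and $f^{(\mathfrak s_f(v))}(v)=f^{(\mathfrak t_f(v))}(v)$. Write $\mathfrak s_n(v)=\mathfrak s_F(v)$, $\mathfrak t_n(v)=\mathfrak t_F(v)$. Notation: $\Delta(\mathbf d_n)=\max_j d_{n,j}$, $m_k(\mathbf d_n)=\sum_j d_{n,j}^k$, $\sigma^2(\mathbf d_n)=m_2(\mathbf d_n)/n-1$. $a_n=\omega(b_n)$ means $b_n=o(a_n)$. *)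

(* Defs.v *)
From Stdlib Require Import Reals Ranalysis Lra.
From mathcomp Require Import all_boot.

Set Implicit Arguments.
Unset Strict Implicit.
Unset Printing Implicit Defensive.

(* Degree sequence on [n] = {0,...,n-1}: d j is the prescribed in-degree of j. *)
Definition is_degree_seq (n : nat) (d : nat -> nat) : Prop :=
  (\sum_(j < n) d j)%N = n.

Definition fibers (n : nat) (d : nat -> nat) : {set {ffun 'I_n -> 'I_n}} :=
  [set f : {ffun 'I_n -> 'I_n} | [forall i : 'I_n, #|[set j | f j == i]| == d i]].

Definition natf (n : nat) (f : {ffun 'I_n -> 'I_n}) (x : nat) : nat :=
  match @insub nat (fun k => k < n) _ x with
  | Some i => nat_of_ord (f i)
  | None => x
  end.

(* six-length: the least k >= 1 with f^k(v) in {f^j(v) : j < k};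
   on an n-element set such a k <= n always exists, so searching 1..n suffices. *)
Definition six_len (n : nat) (g : nat -> nat) (v : nat) : nat :=
  (find (fun k => has (fun j => iter k g v == iter j g v) (iota 0 k)) (iota 1 n)).+1.

(* tail-length: the unique j < s with f^s(v) = f^j(v). *)
Definition tail_len (n : nat) (g : nat -> nat) (v : nat) : nat :=
  let s := six_len n g v in find (fun j => iter s g v == iter j g v) (iota 0 s).

Definition maxdeg (n : nat) (d : nat -> nat) : nat := \max_(j < n) d j.
Definition m2 (n : nat) (d : nat -> nat) : nat := \sum_(j < n) (d j * d j).

Local Open Scope R_scope.

Definition sigma2 (n : nat) (d : nat -> nat) : R := INR (m2 n d) / INR n - 1.

Definition little_o (a b : nat -> R) : Prop :=
  forall eps : R, 0 < eps -> exists N : nat, forall n : nat, (N <= n)%nat ->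
    Rabs (a n) <= eps * Rabs (b n).

Definition Rleb (a b : R) : bool := if Rle_dec a b then true else false.

Definition joint_cdf_n (n : nat) (d : nat -> nat) (v : nat) (x y : R) : R :=
  let c := sqrt (INR n / sigma2 n d) in
  INR #|[set f in fibers n d |
          Rleb (INR (six_len n (natf f) v) / c) x &&
          Rleb (INR (tail_len n (natf f) v) / c) y]|
  / INR #|fibers n d|.

Definition gauss (s : R) : R := exp (- (s * s) / 2).

Lemma gauss_cont : continuity gauss.
Proof. unfold gauss. reg. Qed.

Lemma gauss_integrable (a b : R) : Riemann_integrable gauss a b.
Proof.
  destruct (Rle_dec a b) as [H|H].
  - apply continuity_implies_RiemannInt; [exact H|]. intros; apply gauss_cont.
  - apply RiemannInt_P1. apply continuity_implies_RiemannInt; [lra|].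
    intros; apply gauss_cont.
Qed.

Definition gauss_int (a b : R) : R := RiemannInt (gauss_integrable a b).

(* Joint CDF of (X, U X), X standard Rayleigh (P(X>x)=e^{-x^2/2}), U uniform on
   [0,1], independent:  P(X <= x, U X <= y) = \int_0^x s e^{-s^2/2} min(1, y/s) ds. *)
Definition rayleighU_cdf (x y : R) : R :=
  if Rle_dec x 0 then 0 else
  if Rle_dec y 0 then 0 else
  if Rle_dec x y then 1 - exp (- (x * x) / 2)
  else 1 - exp (- (y * y) / 2) + y * gauss_int y x.

(* Main.v *)
Require Import Defs.
From Coquelicot Require Import Coquelicot.
From Stdlib Require Import Reals Lra.
From mathcomp Require Import all_boot all_fingroup zify.

(* Reveal the orbit of v step by step. By exchangeability, a step from a fresh
   point leads to the vertex b with probability proportional to the number of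
   preimages of b not used yet. Hence, if E_m denotes the sum of the products of
   degrees over the m-tuples of distinct vertices other than v, and Q_m the same
   sum with one factor d_i replaced by d_i (d_i - 1), then
     P(s > m) = E_m / (n)_m,    P(s = m+1, t = l) = Q_m / (n)_(m+1)  for 1 <= l <= m,
   so that t is uniform on 1..m given s = m+1 and t > 0, while
     P(s = m+1, t = 0) = d_v P(s > m) / (n - m).
   Elementary bounds on Q_m / E_m give, with c = sqrt (n / sigma^2),
     c^2 P(s = m+1, t = l) = P(s > m) (1 + o(1))
   uniformly for m = O(c), as soon as c * maxdeg = o(n). Thus P(s > m) approximately
   solves the recursion u_(m+1) = u_m (1 - m / c^2) of the Rayleigh tail
   exp (- (m/c)^2 / 2), and the joint distribution function is a Riemann sum. *)

(** * Counting functions along an orbit *)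

(** This is the exchangeability behind the step-by-step revelation: relabelling arguments moves
    preimages bijectively and keeps their sizes. *)
Lemma fibers_tperm (n : nat) (d : nat -> nat) (a b : 'I_n)
    (f : {ffun 'I_n -> 'I_n}) :
  f \in fibers n d -> [ffun i => f (tperm a b i)] \in fibers n d.
Proof.
rewrite !inE => /forallP F; apply/forallP => i; rewrite -(eqP (F i)).
have -> : [set j | [ffun i => f (tperm a b i)] j == i] =
    tperm a b @^-1: [set j | f j == i].
  by apply/setP => j; rewrite !inE ffunE.
by rewrite card_preimset //; exact: perm_inj.
Qed.

Lemma fibers_nonempty (n : nat) (d : nat -> nat) :
  is_degree_seq n d -> (0 < #|fibers n d|)%N.
Proof.
rewrite /is_degree_seq => dn.
(* The word in which each [i] is repeated [d i] times has length [n]; reading it as a function gives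
   a witness. *)
pose s := flatten [seq nseq (d i) i | i : 'I_n].
have sz : size s = n.
  rewrite size_flatten /shape -map_comp sumnE big_map -[RHS]dn big_enum /=.
  by apply: eq_bigr => i _; rewrite size_nseq.
apply/card_gt0P; exists [ffun j : 'I_n => nth j s j].
rewrite inE; apply/forallP => i.
have -> : #|[set j | [ffun j : 'I_n => nth j s j] j == i]| = count_mem i s.
  rewrite cardsE -sum1_card -[RHS]sum1_count [RHS](big_nth i) sz [RHS]big_mkord.
  apply: eq_bigl => j; rewrite unfold_in /= ffunE.
  by rewrite (set_nth_default i) // sz.
rewrite count_flatten -map_comp sumnE big_map big_enum /=.
rewrite (bigD1 i) //= count_nseq /= eqxx mul1n big1 ?addn0 // => j /negPf ji.
by rewrite count_nseq /= ji.
Qed.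

Lemma eq_in_belast_fpath (T : eqType) (f g : T -> T) (x : T) (s : seq T) :
  {in belast x s, f =1 g} -> fpath f x s = fpath g x s.
Proof.
elim: s x => //= y s IH x fg; rewrite fg ?mem_head // IH // => i iD.
by apply: fg; rewrite inE iD orbT.
Qed.

(* The pairs (f, a) with f(a) = b and a outside the domain of the path are counted
   in two ways: precomposing f with a transposition shows that all such a are alike. *)
Lemma card_fpath_step (n : nat) (d : nat -> nat) (x : 'I_n) (s : seq 'I_n)
    (b : 'I_n) :
  uniq (x :: s) ->
  ((n - size s) * #|[set f in fibers n d | fpath f x s & f (last x s) == b]| =
   (d b - (b \in s)) * #|[set f in fibers n d | fpath f x s]|)%N.
Proof.
move=> us.
have uD : uniq (belast x s) by move: us; rewrite lastI rcons_uniq => /andP[].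
have lD : last x s \notin belast x s.
  by move: us; rewrite lastI rcons_uniq => /andP[].
set C := [set f in fibers n d | fpath f x s].
have fC f : f \in C -> s = map f (belast x s).
  rewrite inE => /andP[_]; elim: s x {us uD lD C} => //= y s IH x.
  by case/andP=> /eqP -> /IH {1}->.
transitivity (\sum_(a | a \notin belast x s) #|[set f in C | f a == b]|)%N.
  rewrite (eq_bigr (fun=> #|[set f in C | f (last x s) == b]|)); last first.
    move=> a aD.
    pose t (f : {ffun 'I_n -> 'I_n}) := [ffun i => f (tperm a (last x s) i)].
    have tK : involutive t.
      by move=> f; apply/ffunP => i; rewrite !ffunE tpermK.
    rewrite -(card_imset _ (inv_inj tK)); apply: eq_card => f.
    have tin g : g \in C -> t g \in C.
      move=> gC; move: (gC); rewrite !inE => /andP[gF gs]; apply/andP; split.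
        by have := fibers_tperm n d a (last x s) g; rewrite !inE; apply.
      have tD i : i \in belast x s -> t g i = g i.
        move=> iD; rewrite ffunE tpermD //.
        - by apply: contraNneq aD => ->.
        - by apply: contraNneq lD => ->.
      by rewrite (eq_in_belast_fpath _ _ _ _ _ tD).
    apply/imsetP/idP.
      case=> g; rewrite inE => /andP[/tin gC gb] ->.
      by rewrite inE gC ffunE tpermR.
    rewrite inE => /andP[/tin gC gb]; exists (t f); last by rewrite tK.
    by rewrite inE gC ffunE tpermL.
  rewrite sum_nat_const; congr (_ * _)%N.
    have -> : #|[pred a | a \notin belast x s]| = (#|'I_n| - #|belast x s|)%N.
      by rewrite -(cardC (mem (belast x s))) addKn; apply: eq_card.
    by rewrite card_ord (card_uniqP uD) size_belast.
  by apply: eq_card => f; rewrite !inE andbA.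
have cardE a : #|[set f in C | f a == b]| = (\sum_(f in C) (f a == b))%N.
  rewrite -sum1_card [RHS]big_mkcond [LHS]big_mkcond /=; apply: eq_bigr => f _.
  by rewrite inE; case: (f \in C) => //=; case: eqP.
transitivity (\sum_(f in C) \sum_(a | a \notin belast x s) (f a == b))%N.
  by rewrite [RHS]exchange_big /=; apply: eq_bigr => a _; exact: cardE.
rewrite (eq_bigr (fun=> (d b - (b \in s))%N)); first by rewrite sum_nat_const mulnC.
move=> f fin.
have db : (\sum_a (f a == b) = d b)%N.
  move: (fin); rewrite !inE => /andP[/forallP/(_ b)/eqP <- _].
  by rewrite -sum1_card [RHS]big_mkcond; apply: eq_bigr => a _; rewrite inE; case: eqP.
(* On the domain of the path, [f] takes the values listed in [s], which are distinct, so [b] is hit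
   there once or not at all. *)
have sb : (\sum_(a in belast x s) (f a == b) = (b \in s))%N.
  rewrite -big_uniq //= -(count_uniq_mem b (s := s)); last by case/andP: us.
  rewrite [in RHS](fC f fin) count_map -sumn_count sumnE big_map.
  by apply: eq_bigr.
by rewrite -sb -db [X in (X - _)%N](bigID (mem (belast x s))) addKn.
Qed.

(** * Weighted sums over tuples of distinct indices *)

(* [m! e_m], where [e_m] is the [m]-th elementary symmetric function of the
   weights [w i], [i] in [A]. *)
Fixpoint wsum (T : finType) (w : T -> nat) (A : {set T}) (m : nat) : nat :=
  if m is m'.+1 then (\sum_(i in A) w i * wsum T w (A :\ i) m')%N else 1%N.

(** The [Q_m] of the overview, for general weights. Truncated subtraction is harmless because of the
    factor [w i]. At [m = 0] the predecessor gives a junk value, which later comes with a factor 0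
    or is excluded where its size matters. *)
Definition wsum_rep (T : finType) (w : T -> nat) (A : {set T}) (m : nat) : nat :=
  (\sum_(i in A) w i * (w i - 1) * wsum T w (A :\ i) m.-1)%N.

Lemma exchange_setD1 (T : finType) (A : {set T}) (F : T -> T -> nat) :
  (\sum_(i in A) \sum_(j in A :\ i) F i j = \sum_(j in A) \sum_(i in A :\ j) F i j)%N.
Proof.
rewrite (exchange_big_dep (mem A)) /=; last by move=> i j _ /setD1P[].
apply: eq_bigr => j jA; apply: eq_bigl => i; rewrite !inE jA andbT andbC.
by rewrite eq_sym.
Qed.

(** Either [i] does not occur in the [m]-tuple, or it occupies exactly one of the [m] positions. *)
Lemma wsum_rec (T : finType) (w : T -> nat) (A : {set T}) (m : nat) (i : T) :
  i \in A ->
  wsum T w A m = (wsum T w (A :\ i) m + m * (w i * wsum T w (A :\ i) m.-1))%N.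
Proof.
elim: m A => [|m IH] A iA; first by rewrite mul0n addn0.
rewrite [LHS]/= (big_setD1 i) //=.
transitivity (w i * wsum T w (A :\ i) m + \sum_(j in A :\ i)
   (w j * wsum T w (A :\ i :\ j) m +
    m * (w i * (w j * wsum T w (A :\ i :\ j) m.-1))))%N.
  congr (_ + _)%N; apply: eq_bigr => j /setD1P[ji jA].
  rewrite (IH (A :\ j)); last by rewrite !inE eq_sym ji.
  by rewrite (setDDl A [set j]) setUC -setDDl; nia.
rewrite big_split /= -big_distrr -big_distrr /= addnCA; congr (_ + _)%N.
rewrite mulSn; congr (_ + _)%N.
by case: m {IH} => [|m]; rewrite ?mul0n.
Qed.

(** Multiply an [m]-tuple by one more weight [w i]: either [i] is new, or it sits at one of the [m]
    positions and produces the square [w i * (w i - 1) + w i]. *)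
Lemma wsum_succ (T : finType) (w : T -> nat) (A : {set T}) (m : nat) :
  (wsum T w A m.+1 + m * wsum_rep T w A m + m * wsum T w A m =
   (\sum_(i in A) w i) * wsum T w A m)%N.
Proof.
rewrite big_distrl /=.
rewrite [RHS](eq_bigr (fun i => w i * wsum T w (A :\ i) m +
   (m * (w i * (w i - 1) * wsum T w (A :\ i) m.-1) +
    m * (w i * wsum T w (A :\ i) m.-1))))%N; last first.
  move=> i iA; rewrite [in LHS](wsum_rec _ _ _ _ i) //; case: (w i) => [|k];
    first by rewrite !mul0n !muln0.
  by rewrite subn1 /=; nia.
rewrite !big_split /= -addnA; congr (_ + (_ + _))%N; rewrite -big_distrr //=.
by case: m => [|m]; rewrite ?mul0n.
Qed.

Lemma wsum_subset (T : finType) (w : T -> nat) (A B : {set T}) (m : nat) :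
  A \subset B -> (wsum T w A m <= wsum T w B m)%N.
Proof.
elim: m A B => //= m IH A B AB.
rewrite [leqRHS](big_setID A) /= (setIidPr AB).
apply: leq_trans (leq_addr _ _); apply: leq_sum => i iA.
by rewrite leq_mul2l IH ?orbT // setSD.
Qed.

Lemma wsum_succ_le (T : finType) (w : T -> nat) (A : {set T}) (m : nat) :
  (wsum T w A m.+1 <= (\sum_(i in A) w i) * wsum T w A m)%N.
Proof. by rewrite -wsum_succ -addnA leq_addr. Qed.

(** In [wsum_succ] the two loss terms add up to squares [w i * w i], each at most [D * w i]. *)
Lemma wsum_succ_ge (T : finType) (w : T -> nat) (A : {set T}) (m D : nat) :
  (forall i, i \in A -> w i <= D)%N ->
  ((\sum_(i in A) w i) * wsum T w A m <=
   wsum T w A m.+1 + m * (D * wsum T w A m))%N.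
Proof.
move=> wD; rewrite -wsum_succ -addnA leq_add2l -mulnDr leq_mul2l.
case: m => //= m; rewrite /wsum_rep /= -big_split /= big_distrr /=.
apply: leq_sum => i /wD; case: (w i) => // k; rewrite subn1 /=; nia.
Qed.

(** Together with [wsum_rep_le], this places [wsum_rep / wsum] close to the ratio of the sums of
    [w i * (w i - 1)] and of [w i]. Both hold term by term in the repeated index [i]; here
    [wsum_rec] at [i] bounds the full sum by the one avoiding [i]. *)
Lemma wsum_rep_ge (T : finType) (w : T -> nat) (A : {set T}) (m D : nat) :
  (forall i, i \in A -> w i <= D)%N ->
  ((\sum_(i in A) w i * (w i - 1)) * wsum T w A m.+1 <=
   (\sum_(i in A) w i + m.+1 * D) * wsum_rep T w A m.+1)%N.
Proof.
move=> wD; rewrite big_distrl /wsum_rep [leqRHS]big_distrr /=.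
apply: leq_sum => i iA; rewrite mulnCA leq_mul2l; apply/orP; right.
change (\sum_(i0 in A) w i0 * wsum T w (A :\ i0) m)%N with (wsum T w A m.+1).
rewrite (wsum_rec _ _ _ _ i) //= mulnDl leq_add //.
  apply: leq_trans (wsum_succ_le _ _ _ _) _; rewrite leq_mul2r.
  by rewrite [X in (_ <= X)%N](big_setD1 i) //= leq_addl orbT.
by rewrite mulnA leq_mul2r leq_mul2l wD ?orbT.
Qed.

Lemma wsum_rep_le (T : finType) (w : T -> nat) (A : {set T}) (m D : nat) :
  (forall i, i \in A -> w i <= D)%N ->
  ((\sum_(i in A) w i) * wsum_rep T w A m.+1 <=
   (\sum_(i in A) w i * (w i - 1)) * wsum T w A m.+1 +
   m.+1 * (D * wsum_rep T w A m.+1))%N.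
Proof.
move=> wD; rewrite mulnA; set E := wsum T w A m.+1.
rewrite /wsum_rep [leqLHS]big_distrr [X in (_ <= _ + X)%N]big_distrr big_distrl -big_split /=.
apply: leq_sum => i iA.
set p := (w i * _)%N; set e := wsum T w _ m.
(* Removing [i] from the total weight costs at most [D], and [wsum_succ_ge] on the remaining set
   costs [m * D], which makes [m.+1 * D]. *)
suff: ((\sum_(i in A) w i) * e <= E + m.+1 * (D * e))%N by nia.
have wD' : forall j, j \in A :\ i -> (w j <= D)%N by move=> j /setD1P[_ /wD].
have H1 := wsum_succ_ge T w (A :\ i) m D wD'.
have H2 : (wsum T w (A :\ i) m.+1 <= E)%N by rewrite wsum_subset ?subsetDl.
rewrite (big_setD1 i) //= -/e mulnDl.
apply: leq_trans (leq_add (leq_mul (wD i iA) (leqnn e)) H1) _.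
by rewrite -/e; nia.
Qed.

(** * Orbits that close up at a given index *)

(** Sorts the functions by the next vertex of the orbit. The event [Q] is one that forces this
    vertex to be fresh, so no other value contributes. *)
Lemma card_partition_next (n : nat) (C : {set {ffun 'I_n -> 'I_n}}) (x : 'I_n)
    (s : seq 'I_n) (Q : pred {ffun 'I_n -> 'I_n}) :
  (forall f, Q f -> fpath f x s -> f (last x s) \notin x :: s) ->
  #|[set f in C | fpath f x s & Q f]| =
  (\sum_(b in ~: [set y in x :: s])
     #|[set f in C | fpath f x (rcons s b) & Q f]|)%N.
Proof.
move=> Qs; rewrite -sum1_card.
rewrite (partition_big (fun f : {ffun 'I_n -> 'I_n} => f (last x s))
  (mem (~: [set y in x :: s]))) /=; last first.
  by move=> f; rewrite !inE => /and3P[_ fs /Qs /(_ fs)]; rewrite inE.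
apply: eq_bigr => b _; rewrite -sum1_card; apply: eq_bigl => f.
by rewrite !inE rcons_path /= -!andbA [_ && (Q f)]andbC.
Qed.

Lemma traject_of_fpath (T : eqType) (f : T -> T) (x : T) (s : seq T) :
  fpath f x s -> traject f x (size s).+1 = x :: s.
Proof. by move=> /fpathP[k ->]; rewrite size_traject. Qed.

Lemma fpath_iter (T : eqType) (f : T -> T) (x : T) (s : seq T) (i : nat) :
  fpath f x s -> (i <= size s)%N -> iter i f x = nth x (x :: s) i.
Proof. by move=> fs le; rewrite -(traject_of_fpath _ _ _ _ fs) nth_traject. Qed.

Lemma traject_prefix (T : eqType) (f : T -> T) (x : T) (s : seq T) (m : nat) :
  fpath f x s -> traject f x (size s + m).+1 = x :: s ++ traject f (f (last x s)) m.
Proof.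
move=> /fpathP[k ->]; rewrite size_traject last_traject /= trajectD.
by rewrite -iterSr -iterS.
Qed.

Lemma compl_rcons (T : finType) (x : T) (s : seq T) (b : T) :
  ~: [set y in x :: rcons s b] = ~: [set y in x :: s] :\ b.
Proof. by apply/setP => y; rewrite !inE mem_rcons inE !negb_or; do !case: eqP. Qed.

Lemma uniq_traject_fresh (T : eqType) (f : T -> T) (x : T) (s : seq T) (m : nat) :
  uniq (traject f x (size s + m.+1).+1) -> fpath f x s -> f (last x s) \notin x :: s.
Proof.
move=> + fs; rewrite traject_prefix // -cat_cons cat_uniq trajectS => /and3P[_].
by rewrite /= negb_or => /andP[].
Qed.

Lemma card_fpath_rcons (n : nat) (d : nat -> nat) (x : 'I_n) (s : seq 'I_n) (b : 'I_n) :
  b \notin x :: s -> uniq (x :: s) ->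
  ((n - size s) * #|[set f in fibers n d | fpath f x (rcons s b)]| =
   d b * #|[set f in fibers n d | fpath f x s]|)%N.
Proof.
rewrite inE negb_or => /andP[_ /negPf bs] us.
have := card_fpath_step n d x s b us; rewrite bs subn0 => <-; congr (_ * _)%N.
by apply: eq_card => f; rewrite !inE rcons_path.
Qed.

(* The orbit of x closes up at index l. If l lies on the given path, the closing step
   has a fixed weight; otherwise (next lemma) it hits a vertex that is already used
   once, and the resulting count does not depend on l. *)
Lemma card_rho_old (n : nat) (d : nat -> nat) (x : 'I_n) (l m : nat) (s : seq 'I_n) :
  uniq (x :: s) -> (l <= size s)%N ->
  ((n - size s) ^_ m.+1 *
     #|[set f in fibers n d | fpath f x s & uniq (traject f x (size s + m).+1)
          && (iter (size s + m).+1 f x == iter l f x)]| =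
   #|[set f in fibers n d | fpath f x s]| *
     (wsum 'I_n (fun i => d i) (~: [set y in x :: s]) m *
      (d (nth x (x :: s) l) - (0 < l))))%N.
Proof.
elim: m s => [|m IH] s us ls.
  rewrite ffactn1 mul1n; set y := nth x _ l.
  (* Every vertex of the path except its start has one preimage used already, hence the correction
     [0 < l] to the degree. *)
  have -> : ((0 < l) = (y \in s) :> bool)%N.
    rewrite /y; case: l ls {y} => [|l] ls /=; last by rewrite mem_nth.
    by case/andP: us => /negPf->.
  rewrite [RHS]mulnC -card_fpath_step //; congr (_ * _)%N; apply: eq_card => f.
  rewrite !inE addn0; case: (boolP (fpath f x s)) => [fs|]; rewrite ?andbF //.
  rewrite traject_of_fpath // us !andTb iterS (fpath_iter _ _ _ s) // (fpath_iter _ _ _ s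
    l) //.
  by rewrite -last_nth.
rewrite card_partition_next; last by move=> f /andP[+ _]; exact: uniq_traject_fresh.
rewrite [wsum _ _ _ m.+1]/= big_distrl !big_distrr /=; apply: eq_bigr => b;
  rewrite inE inE => bs.
have us' : uniq (x :: rcons s b).
  by rewrite -rcons_cons rcons_uniq bs.
have := IH (rcons s b) us'; rewrite size_rcons addSnnS subnS compl_rcons.
rewrite (leq_trans ls) // => /(_ isT) {}IH.
rewrite ffactnS -mulnA IH mulnA card_fpath_rcons //.
rewrite -rcons_cons nth_rcons /= ltnS ls.
by rewrite -!mulnA mulnCA.
Qed.

Lemma card_rho_new (n : nat) (d : nat -> nat) (x : 'I_n) (l m : nat) (s : seq 'I_n) :
  uniq (x :: s) -> (size s < l <= size s + m)%N ->
  ((n - size s) ^_ m.+1 *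
     #|[set f in fibers n d | fpath f x s & uniq (traject f x (size s + m).+1)
          && (iter (size s + m).+1 f x == iter l f x)]| =
   #|[set f in fibers n d | fpath f x s]| *
     wsum_rep 'I_n (fun i => d i) (~: [set y in x :: s]) m)%N.
Proof.
elim: m s => [|m IH] s us /andP[sl ls]; first by move: ls; rewrite addn0 leqNgt sl.
rewrite card_partition_next; last by move=> f /andP[+ _]; exact: uniq_traject_fresh.
have us' b : b \in ~: [set y in x :: s] -> uniq (x :: rcons s b).
  by rewrite inE inE => bs; rewrite -rcons_cons rcons_uniq bs.
rewrite big_distrr /=.
(* If [l] is the index of the very next vertex [b], then [b] has lost one preimage and
   [card_rho_old] gives the weight [d b * (d b - 1)]. If [l] lies further on, induction applies
   after revealing [b]. *)
case: (ltnP (size s).+1 l) => sl'; last first.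
  rewrite /wsum_rep big_distrr /=; apply: eq_bigr => b bs.
  have {sl sl'} le : l = (size s).+1 by apply/eqP; rewrite eqn_leq sl'.
  have := card_rho_old n d x l m (rcons s b) (us' b bs).
  rewrite size_rcons addSnnS subnS compl_rcons le => /(_ (leqnn _)) => H.
  rewrite ffactnS -mulnA H mulnA card_fpath_rcons //; last by move: bs; rewrite inE inE.
  by rewrite -rcons_cons nth_rcons /= ltnn eqxx [in RHS]mulnAC -!mulnA mulnCA (mulnCA (d b)).
transitivity (\sum_(b in ~: [set y in x :: s]) \sum_(i in ~: [set y in x :: s] :\ b)
  #|[set f in fibers n d | fpath f x s]| * (d i * (d i - 1) *
   (d b * wsum 'I_n (fun i => d i) (~: [set y in x :: s] :\ b :\ i) m.-1)))%N.
  apply: eq_bigr => b bs.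
  have := IH (rcons s b) (us' b bs).
  rewrite size_rcons addSnnS subnS compl_rcons sl' ls => /(_ isT) => H.
  rewrite ffactnS -mulnA H mulnA card_fpath_rcons //; last by move: bs; rewrite inE inE.
  rewrite /wsum_rep big_distrr /=; apply: eq_bigr => i _.
  by rewrite -[LHS]mulnA mulnCA (mulnCA (d b)).
(* Summing over the revealed vertex [b] inside the closing vertex [i] lengthens the tuple by one
   entry. Here [m] is positive, because [l] lies beyond the next vertex. *)
rewrite exchange_setD1 /wsum_rep big_distrr /=; apply: eq_bigr => i iA.
rewrite -big_distrr -big_distrr /=; do 2!congr (_ * _)%N.
case: m ls {IH} => [|m] ls; first by move: sl' ls; rewrite addn1; lia.
by apply: eq_bigr => b bA; rewrite !setDDl (setUC [set b]).
Qed.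

(** * Six-length and tail-length *)

Lemma iter_natf (n : nat) (f : {ffun 'I_n -> 'I_n}) (k : nat) (x : 'I_n) :
  iter k (natf f) x = iter k f x :> nat.
Proof. by elim: k => //= k ->; rewrite /natf valK. Qed.

Lemma find_iota_eq (P : pred nat) (a k i : nat) :
  (i < k)%N -> (find P (iota a k) == i) = P (a + i)%N && all (predC P) (iota a i).
Proof.
move=> ik; rewrite -(subnKC (ltnW ik)) iotaD find_cat all_predC size_iota.
case: ifPn => [h|_].
  by rewrite andbF; apply/negbTE; rewrite neq_ltn -{2}(size_iota a i) -has_find h.
rewrite andbT -[X in _ == X]addn0 eqn_add2l.
have : (0 < k - i)%N by rewrite subn_gt0.
by case: (k - i)%N => //= j _; case: (P _).
Qed.

Lemma uniq_traject_all (g : nat -> nat) (v m : nat) :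
  uniq (traject g v m.+1) =
  all (predC (fun k => has (fun j => iter k g v == iter j g v) (iota 0 k))) (iota 1 m).
Proof.
elim: m => // m IH.
have -> : iota 1 m.+1 = rcons (iota 1 m) m.+1.
  by rewrite -[in LHS](addn1 m) iotaD add1n cats1.
rewrite trajectSr rcons_uniq IH all_rcons.
congr (~~ _ && _); apply/trajectP/hasP.
  by case=> i im ->; exists i; rewrite ?mem_iota.
by case=> i; rewrite mem_iota => /andP[_ im] /eqP ?; exists i.
Qed.

Lemma six_len_eq (n : nat) (g : nat -> nat) (v m : nat) :
  (m < n)%N -> (six_len n g v == m.+1) =
    has (fun j => iter m.+1 g v == iter j g v) (iota 0 m.+1) &&
    uniq (traject g v m.+1).
Proof.
by move=> mn; rewrite uniq_traject_all /six_len eqSS find_iota_eq.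
Qed.

(** Translates the event into the orbit pattern counted by [card_rho_old] and [card_rho_new]. *)
Lemma six_tail_eq (n : nat) (g : nat -> nat) (v m l : nat) :
  (m < n)%N -> (l <= m)%N ->
  (six_len n g v == m.+1) && (tail_len n g v == l) =
  uniq (traject g v m.+1) && (iter m.+1 g v == iter l g v).
Proof.
move=> mn lm; apply/andP/andP.
  case=> /eqP s; rewrite /tail_len s find_iota_eq // => /andP[/eqP e _].
  by move/eqP: s; rewrite six_len_eq // => /andP[_ ->]; rewrite e.
case=> u /eqP e; have s : six_len n g v == m.+1.
  rewrite six_len_eq // u andbT; apply/hasP; exists l; last by rewrite e.
  by rewrite mem_iota.
split=> //; rewrite /tail_len (eqP s) find_iota_eq // add0n e eqxx /=.
(* An earlier index [j] closing the orbit would give the same point as [l], against distinctness. *)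
apply/allP => j; rewrite mem_iota /= add0n => jl; apply/negP => /eqP ij.
have := nth_uniq v (s := traject g v m.+1) (i := l) (j := j).
have lm' : (l < m.+1)%N by [].
rewrite size_traject => /(_ lm' (ltn_trans jl lm') u).
by rewrite !nth_traject ?(ltn_trans jl lm') // ij eqxx => /esym; rewrite gtn_eqF.
Qed.

(** The hypothesis excludes the default value [n.+1] of an unsuccessful search; the search behind
    [tail_len] then succeeds as well. *)
Lemma tail_lt_six (n : nat) (g : nat -> nat) (v : nat) :
  (six_len n g v <= n)%N -> (tail_len n g v < six_len n g v)%N.
Proof.
case e : (six_len n g v) => [|m] // mn; rewrite /tail_len e.
rewrite -[X in (_ < X)%N](size_iota 0) -has_find.
by have := six_len_eq n g v m mn; rewrite e eqxx => /esym/andP[].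
Qed.

Lemma card_lt_sum (T : finType) (C : {set T}) (P : pred T) (h : T -> nat) (K : nat) :
  #|[set f in C | P f & (h f < K)%N]| = (\sum_(m < K) #|[set f in C | P f & h f == m]|)%N.
Proof.
elim: K => [|K IH].
  by rewrite big_ord0; apply: eq_card0 => f; rewrite !inE !andbF.
rewrite big_ord_recr /= -IH -cardsUI [X in (_ + X)%N]eq_card0 ?addn0.
  apply: eq_card => f; rewrite !inE ltnS leq_eqVlt.
  by case: (f \in C); case: (P f); rewrite //= orbC.
move=> f; rewrite !inE; case: (f \in C); case: (P f) => //=.
by case: ltngtP.
Qed.

Lemma card_joint (n : nat) (d : nat -> nat) (x : 'I_n) (K T : nat) :
  (K <= n)%N ->
  #|[set f in fibers n d |
      (six_len n (natf f) x <= K)%N && (tail_len n (natf f) x <= T)%N]| =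
  (\sum_(m < K) \sum_(l < (minn T m).+1)
     #|[set f in fibers n d |
        uniq (traject f x m.+1) && (iter m.+1 f x == iter l f x)]|)%N.
Proof.
move: (fibers n d) => C Kn.
transitivity #|[set f in C | (tail_len n (natf f) x <= T)%N &
    ((six_len n (natf f) x).-1 < K)%N]|.
  by apply: eq_card => f; rewrite !inE [X in _ && X]andbC.
rewrite card_lt_sum; apply: eq_bigr => m _.
have mn : (m < n)%N by rewrite (leq_trans (ltn_ord m)).
(* Once the six-length is [m.+1], the tail-length is at most [m], so its bound becomes
   [minn T m]. *)
transitivity #|[set f in C | six_len n (natf f) x == m.+1 &
    (tail_len n (natf f) x < (minn T m).+1)%N]|.
  apply: eq_card => f; rewrite !inE; congr (_ && _).
  change ((six_len n (natf f) x).-1 == m) with (six_len n (natf f) x == m.+1).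
  rewrite andbC; case: eqP => //= e.
  have := tail_lt_six n (natf f) x; rewrite e !ltnS leq_min => /(_ mn) ->.
  by rewrite andbT.
rewrite card_lt_sum; apply: eq_bigr => l _; apply: eq_card => f.
rewrite !inE six_tail_eq //; last first.
  by have := ltn_ord l; rewrite ltnS leq_min => /andP[].
congr (_ && (_ && _)).
  have -> : traject (natf f) x m.+1 = map val (traject f x m.+1).
    by elim: (m.+1) x => //= k IH y; rewrite -IH /natf valK.
  by rewrite (map_inj_uniq val_inj).
by rewrite !iter_natf.
Qed.

(** * From counts to real partial sums *)

Open Scope R_scope.

Fixpoint psum (u : nat -> R) (k : nat) : R :=
  if k is k'.+1 then (psum u k' + u k') else 0.

Lemma psumS (u : nat -> R) (k : nat) : psum u k.+1 = psum u k + u k.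
Proof. by []. Qed.

Lemma INR_sum (K : nat) (F : nat -> nat) :
  INR (\sum_(m < K) F m)%N = psum (fun m => INR (F m)) K.
Proof.
elim: K => [|K IH]; first by rewrite big_ord0.
by rewrite big_ord_recr /= plus_INR IH.
Qed.

Lemma Rdiv_eq_cross (a b c e : R) :
  b <> 0 -> e <> 0 -> e * a = b * c -> a / b = c / e.
Proof.
move=> b0 e0 H; apply: (Rmult_eq_reg_l (b * e));
  last exact: Rmult_integral_contrapositive_currified.
by transitivity (e * a); [field | rewrite H; field].
Qed.

(** Both closing counts are used with the empty path: tail-length 0 contributes the term with [d x],
    and each of the [minn T m] positive tail-lengths contributes the same [wsum_rep]. *)
Lemma card_joint_fraction (n : nat) (d : nat -> nat) (x : 'I_n) (K T : nat) :
  is_degree_seq n d -> (K <= n)%N ->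
  (INR #|[set f in fibers n d |
      (six_len n (natf f) x <= K)%N && (tail_len n (natf f) x <= T)%N]|
    / INR #|fibers n d| =
  psum (fun m => (INR (d x) * INR (wsum 'I_n (fun i => d i) (~: [set x]) m) +
     INR (minn T m) * INR (wsum_rep 'I_n (fun i => d i) (~: [set x]) m)) /
     INR (n ^_ m.+1)%N) K).
Proof.
move=> dn Kn; have F0 : (0 < INR #|fibers n d|).
  by apply/lt_0_INR/ltP; exact: fibers_nonempty.
rewrite card_joint //.
rewrite (INR_sum K (fun m => \sum_(l < (minn T m).+1) #|[set f in fibers n d |
  uniq (traject f x m.+1) && (iter m.+1 f x == iter l f x)]|)%N).
elim: K Kn => [|K IH] Kn; first by rewrite /= /Rdiv Rmult_0_l.
rewrite !psumS Rdiv_plus_distr IH; last exact: ltnW.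
congr (_ + _).
have P0 : (0 < INR (n ^_ K.+1)) by apply/lt_0_INR/ltP; rewrite ffact_gt0.
apply: Rdiv_eq_cross. 1,2: exact: Rgt_not_eq.
rewrite -!mult_INR -plus_INR -!mult_INR ?multE ?plusE; congr INR.
rewrite big_distrr /= big_ord_recl.
have xs : [set y in [:: x]] = [set x] by apply/setP => y; rewrite !inE.
have all_f : #|[set f in fibers n d | fpath f x [::]]| = #|fibers n d|.
  by apply: eq_card => f; rewrite in_set andbT.
have := card_rho_old n d x 0 K [::] isT (leqnn _).
rewrite xs all_f subn0 subn0 => e0.
rewrite [X in (X + _)%N](_ : _ = #|fibers n d| * (wsum 'I_n (fun i => d i) (~: [set x]) K *
  d x))%N; last first.
  by rewrite -e0; congr (_ * _)%N; apply: eq_card => f; rewrite !in_set.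
rewrite (eq_bigr (fun=> #|fibers n d| * wsum_rep 'I_n (fun i => d i) (~: [set x]) K))%N;
  last first.
  move=> l _; have lK : (0 < l.+1 <= 0 + K)%N by have := ltn_ord l; rewrite leq_min => /andP[].
  have := card_rho_new n d x l.+1 K [::] isT lK.
  rewrite xs all_f subn0 => <-.
  by congr (_ * _)%N; apply: eq_card => f; rewrite !in_set.
by rewrite sum_nat_const card_ord mulnDr (mulnC (d x)) (mulnCA (minn _ _)).
Qed.

(** * Bounds on the step probabilities *)

(* Probability that [x, f x, .., f^m x] are distinct. *)
Definition simple_prob (n : nat) (d : nat -> nat) (x : 'I_n) (m : nat) : R :=
  INR (wsum 'I_n (fun i => d i) (~: [set x]) m) / INR (n ^_ m)%N.

(* Probability of six-length [m+1] and tail-length [l], for any [1 <= l <= m]. *)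
Definition rho_prob (n : nat) (d : nat -> nat) (x : 'I_n) (m : nat) : R :=
  INR (wsum_rep 'I_n (fun i => d i) (~: [set x]) m) / INR (n ^_ m.+1)%N.

(* Probability of six-length [m+1] and tail-length [0]. *)
Definition cycle_prob (n : nat) (d : nat -> nat) (x : 'I_n) (m : nat) : R :=
  INR (d x) * INR (wsum 'I_n (fun i => d i) (~: [set x]) m) / INR (n ^_ m.+1)%N.

Lemma sum_setC1 (T : finType) (F : T -> nat) (x : T) :
  (\sum_i F i = F x + \sum_(i in ~: [set x]) F i)%N.
Proof.
by rewrite (bigD1 x) //=; congr (_ + _)%N; apply: eq_bigl => i; rewrite !inE.
Qed.

Lemma degree_sum_setC1 (n : nat) (d : nat -> nat) (x : 'I_n) :
  is_degree_seq n d -> (\sum_(i in ~: [set x]) d i + d x = n)%N.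
Proof. by move=> dn; rewrite addnC -(sum_setC1 'I_n (fun i => d i) x). Qed.

Lemma deg_le_maxdeg (n : nat) (d : nat -> nat) (i : 'I_n) : (d i <= maxdeg n d)%N.
Proof. exact: (leq_bigmax (F := fun j : 'I_n => d j)). Qed.

Lemma maxdeg_gt0 (n : nat) (d : nat -> nat) :
  is_degree_seq n d -> (0 < n)%N -> (0 < maxdeg n d)%N.
Proof.
move=> dn n0; rewrite lt0n; apply/negP => /eqP m0.
move: dn n0; rewrite /is_degree_seq big1 => [<- //|i _].
by apply/eqP; rewrite -leqn0 -m0 deg_le_maxdeg.
Qed.

(** Since [d * d = d * (d - 1) + d] and the degrees sum to [n], this identifies [n * sigma2] with
    the sum of [d i * (d i - 1)]; the term of [x] is set apart because the tuples avoid [x]. *)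
Lemma m2_setC1 (n : nat) (d : nat -> nat) (x : 'I_n) :
  is_degree_seq n d ->
  (\sum_(i in ~: [set x]) d i * (d i - 1) + d x * (d x - 1) + n = m2 n d)%N.
Proof.
move=> dn; rewrite -[X in (_ + X)%N]dn /m2.
rewrite (sum_setC1 'I_n (fun i => d i) x) (sum_setC1 'I_n (fun i => d i * d i)%N x).
rewrite [X in (_ + X = _)%N]addnC addnACA -big_split /= addnC; congr (_ + _)%N.
  by case: (d x) => // k; rewrite subn1 /=; nia.
by apply: eq_bigr => i _; case: (d i) => // k; rewrite subn1 /=; nia.
Qed.

Lemma INR_leq (a b : nat) : (a <= b)%N -> INR a <= INR b.
Proof. by move=> /leP; exact: le_INR. Qed.

Lemma INR_ffact_gt0 (n m : nat) : (m <= n)%N -> 0 < INR (n ^_ m)%N.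
Proof. by move=> mn; apply/lt_0_INR/ltP; rewrite ffact_gt0. Qed.

Lemma simple_prob0 (n : nat) (d : nat -> nat) (x : 'I_n) : simple_prob n d x 0 = 1.
Proof. by rewrite /simple_prob ffactn0 /=; field. Qed.

Lemma simple_prob_ge0 (n : nat) (d : nat -> nat) (x : 'I_n) (m : nat) :
  (m <= n)%N -> 0 <= simple_prob n d x m.
Proof.
move=> mn; apply: Rmult_le_pos; first exact: pos_INR.
by apply/Rlt_le/Rinv_0_lt_compat/INR_ffact_gt0.
Qed.

Lemma rho_prob_ge0 (n : nat) (d : nat -> nat) (x : 'I_n) (m : nat) :
  (m < n)%N -> 0 <= rho_prob n d x m.
Proof.
move=> mn; apply: Rmult_le_pos; first exact: pos_INR.
by apply/Rlt_le/Rinv_0_lt_compat/INR_ffact_gt0.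
Qed.

Lemma cycle_prob_mul (n : nat) (d : nat -> nat) (x : 'I_n) (m : nat) :
  (m < n)%N ->
  cycle_prob n d x m * (INR n - INR m) = INR (d x) * simple_prob n d x m.
Proof.
move=> mn; rewrite /cycle_prob /simple_prob ffactnSr mult_INR minus_INR; last by apply/leP;
  rewrite ltnW.
have P := INR_ffact_gt0 n m (ltnW mn).
have Q : INR m < INR n by apply/lt_INR/ltP.
by field; lra.
Qed.

(** This is [wsum_succ] divided by the falling factorial: the weight available outside [x] is
    [n - d x], and the missing [d x] is the chance of closing at the start. *)
Lemma simple_prob_succ (n : nat) (d : nat -> nat) (x : 'I_n) (m : nat) :
  is_degree_seq n d -> (m < n)%N ->
  simple_prob n d x m - simple_prob n d x m.+1 =
  INR m * rho_prob n d x m + cycle_prob n d x m.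
Proof.
move=> dn mn.
have := wsum_succ 'I_n (fun i => d i) (~: [set x]) m.
have := degree_sum_setC1 n d x dn.
rewrite /simple_prob /rho_prob /cycle_prob.
rewrite ffactnSr mult_INR minus_INR; last by apply/leP; rewrite ltnW.
have := INR_ffact_gt0 n m (ltnW mn); set p := INR (n ^_ m)%N => P.
set A := bigop.body _ _ _; set E := wsum _ _ _ m; set E' := wsum _ _ _ m.+1;
  set Q := wsum_rep _ _ _ _.
move=> dA H.
have {H} : (E' + m * Q + m * E + d x * E = n * E)%N.
  by transitivity ((A + d x) * E)%N; [rewrite mulnDl H | rewrite dA].
move/(f_equal INR); rewrite !plus_INR !mult_INR => H.
have R : INR m < INR n by apply/lt_INR/ltP.
apply: (Rmult_eq_reg_r (p * (INR n - INR m))); last by apply: Rgt_not_eq; nra.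
rewrite Rmult_plus_distr_r Rmult_minus_distr_r.
set q := INR n - INR m.
have q0 : 0 < q by rewrite /q; lra.
transitivity (INR E * q - INR E'); first by field; lra.
transitivity (INR m * INR Q + INR (d x) * INR E); first by rewrite /q; lra.
by field; lra.
Qed.

Lemma simple_prob_le1 (n : nat) (d : nat -> nat) (x : 'I_n) (m : nat) :
  is_degree_seq n d -> (m <= n)%N -> simple_prob n d x m <= 1.
Proof.
move=> dn; elim: m => [|m IH] mn; first by rewrite simple_prob0; lra.
have := simple_prob_succ n d x m dn mn.
have := rho_prob_ge0 n d x m mn.
have := cycle_prob_mul n d x m mn.
have := simple_prob_ge0 n d x m (ltnW mn).
have := pos_INR m; have := pos_INR (d x).
have := IH (ltnW mn).
have Q : INR m < INR n by apply/lt_INR/ltP.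
move=> H1 H2 H3 H4 H5 H6 H7.
have : 0 <= cycle_prob n d x m.
  apply: (Rmult_le_reg_r (INR n - INR m)); [lra | rewrite H5; nra].
nra.
Qed.

(** Normalised form of [wsum_rep_ge]. The subtracted square bounds [d x * (d x - 1)], the share of
    [x] in [n * sigma2]. *)
Lemma rho_prob_ge (n : nat) (d : nat -> nat) (x : 'I_n) (m : nat) :
  is_degree_seq n d -> (0 < m < n)%N ->
  (INR n * sigma2 n d - INR (d x) * INR (d x)) * simple_prob n d x m <=
  (INR n + INR m * INR (maxdeg n d)) * (INR n - INR m) * rho_prob n d x m.
Proof.
case: m => // m dn /andP[_ mn].
have := wsum_rep_ge 'I_n (fun i => d i) (~: [set x]) m (maxdeg n d) (fun i _ =>
  deg_le_maxdeg n d i).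
have := degree_sum_setC1 n d x dn; have := m2_setC1 n d x dn.
rewrite /simple_prob /rho_prob /sigma2.
rewrite (ffactnSr n m.+1) (mult_INR (n ^_ m.+1)) minus_INR; last by apply/leP; rewrite ltnW.
have := INR_ffact_gt0 n m.+1 (ltnW mn); set p := INR (n ^_ m.+1)%N => P.
set W := bigop.body _ _ _; set A := bigop.body _ _ _; set E := wsum _ _ _ _;
  set Q := wsum_rep _ _ _ _; set D := maxdeg _ _.
move=> <- dA H.
have {H} /INR_leq : (W * E <= (n + m.+1 * D) * Q)%N.
  by apply: leq_trans H _; rewrite leq_mul2r; apply/orP; right; move: dA; clear; lia.
rewrite !mult_INR !plus_INR !mult_INR.
have -> : INR D + INR m * INR D = INR m.+1 * INR D by rewrite S_INR; ring.
move=> H.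
have R : INR m.+1 < INR n by apply/lt_INR/ltP.
have R0 := pos_INR m.+1.
have -> : INR n * ((INR W + INR (d x) * INR (d x - 1) + INR n) / INR n - 1) =
    INR W + INR (d x) * INR (d x - 1) by field; lra.
apply: (Rmult_le_reg_r p) => //.
have -> : (INR n + INR m.+1 * INR D) * (INR n - INR m.+1) * (INR Q / (p * (INR n - INR
  m.+1))) * p =
  (INR n + INR m.+1 * INR D) * INR Q by field; lra.
rewrite Rmult_assoc /Rdiv Rmult_assoc Rinv_l ?Rmult_1_r; last lra.
apply: (Rle_trans _ _ _ _ H); apply: Rmult_le_compat_r; first exact: pos_INR.
have := INR_leq _ _ (leq_subr 1 (d x)); have := pos_INR (d x); nra.
Qed.

(** Normalised form of [wsum_rep_le]. The weight outside [x] is at least [n - maxdeg]; this extra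
    [maxdeg] turns the factor [m] into [m.+1]. *)
Lemma rho_prob_le (n : nat) (d : nat -> nat) (x : 'I_n) (m : nat) :
  is_degree_seq n d -> (0 < m < n)%N ->
  (INR n - INR m.+1 * INR (maxdeg n d)) * (INR n - INR m) * rho_prob n d x m <=
  INR n * sigma2 n d * simple_prob n d x m.
Proof.
case: m => // m dn /andP[_ mn].
have := wsum_rep_le 'I_n (fun i => d i) (~: [set x]) m (maxdeg n d) (fun i _ =>
  deg_le_maxdeg n d i).
have := degree_sum_setC1 n d x dn; have := m2_setC1 n d x dn.
rewrite /simple_prob /rho_prob /sigma2.
rewrite (ffactnSr n m.+1) (mult_INR (n ^_ m.+1)) minus_INR; last by apply/leP; rewrite ltnW.
have := INR_ffact_gt0 n m.+1 (ltnW mn); set p := INR (n ^_ m.+1)%N => P.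
set W := bigop.body _ _ _; set A := bigop.body _ _ _; set E := wsum _ _ _ _;
  set Q := wsum_rep _ _ _ _.
have /INR_leq dD := deg_le_maxdeg n d x.
move: dD; set D := maxdeg _ _ => dD.
move=> <- /(f_equal INR); rewrite plus_INR => dA /INR_leq.
rewrite !plus_INR !mult_INR.
have -> : INR D * INR Q + INR m * (INR D * INR Q) = INR m.+1 * (INR D * INR Q) by rewrite
  S_INR; ring.
move=> H.
have R : INR m.+1 < INR n by apply/lt_INR/ltP.
have R0 := pos_INR m.+1.
rewrite (S_INR m.+1).
have -> : INR n * ((INR W + INR (d x) * INR (d x - 1) + INR n) / INR n - 1) =
    INR W + INR (d x) * INR (d x - 1) by field; lra.
apply: (Rmult_le_reg_r p) => //.
set k := INR m.+1 in R R0 H *.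
have -> : (INR n - (k + 1) * INR D) * (INR n - k) * (INR Q / (p * (INR n - k))) * p =
  (INR n - (k + 1) * INR D) * INR Q by field; lra.
rewrite Rmult_assoc /Rdiv Rmult_assoc Rinv_l ?Rmult_1_r; last lra.
have H1 := pos_INR Q; have H2 := pos_INR E; have H3 := pos_INR (d x).
have H4 := pos_INR (d x - 1)%N.
have H5 : 0 <= INR (d x) * INR (d x - 1) * INR E by apply: Rmult_le_pos => //; nra.
have H6 : INR (d x) * INR Q <= INR D * INR Q by apply: Rmult_le_compat_r.
nra.
Qed.

(** * The Gaussian density *)

Lemma gauss_bounds (s : R) : 0 < gauss s <= 1.
Proof.
split; first exact: exp_pos.
rewrite /gauss -exp_0; case: (Req_dec s 0) => [->|s0].
  by right; congr exp; field.
by left; apply: exp_increasing; nra.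
Qed.

(** From [1 + s * s / 2 <= exp (s * s / 2)]. It bounds the first and second derivatives of [gauss]
    by 2, the source of the constants 2 below. *)
Lemma gauss_weight_le (s : R) : (1 + s * s) * gauss s <= 2.
Proof.
have := exp_ineq1_le (s * s / 2); have [g0 _] := gauss_bounds s.
have : gauss s * exp (s * s / 2) = 1.
  by rewrite /gauss -exp_plus -exp_0; congr exp; field.
by nra.
Qed.

Lemma MVT_abs_le (f df : R -> R) (a b M : R) :
  a <= b -> (forall s, a <= s <= b -> is_derive f s (df s)) ->
  (forall s, a <= s <= b -> Rabs (df s) <= M) -> Rabs (f b - f a) <= M * (b - a).
Proof.
move=> ab D B; case: (Req_dec a b) => [<-|ne].
  by rewrite !Rminus_diag Rabs_R0; lra.
have lt : a < b by lra.
have D' s : a <= s <= b -> derivable_pt_lim f s (df s) by move=> hs; apply/is_derive_Reals/D.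
have [s [-> [s1 s2]]] := MVT_cor2 f df a b lt D'.
rewrite Rabs_mult (Rabs_pos_eq (b - a)); last lra.
by apply: Rmult_le_compat_r; [lra | apply: B; lra].
Qed.

Lemma is_derive_gauss (s : R) : is_derive gauss s (- s * gauss s).
Proof. rewrite /gauss; auto_derive => //; rewrite /Rdiv; field. Qed.

Lemma gauss_lipschitz (a b : R) : a <= b -> Rabs (gauss b - gauss a) <= 2 * (b - a).
Proof.
move=> ab; apply: (MVT_abs_le _ (fun s => - s * gauss s)) => // s _.
  exact: is_derive_gauss.
have := gauss_weight_le s; have := gauss_bounds s => -[g0 g1] w.
rewrite Rabs_mult Rabs_Ropp (Rabs_pos_eq (gauss s)); last lra.
by have : Rabs s <= 1 + s * s; [apply: Rabs_le; nra | nra].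
Qed.

Lemma gauss_taylor (s h : R) :
  0 <= h -> Rabs (gauss (s + h) - gauss s + h * (s * gauss s)) <= 2 * (h * h).
Proof.
(* [psi] is, up to a constant, the first-order Taylor remainder. Its derivative is a difference of
   two values of [gauss'], so the mean value bound is applied twice. *)
move=> h0; pose psi u := gauss (s + u) + u * (s * gauss s).
have -> : gauss (s + h) - gauss s + h * (s * gauss s) = psi h - psi 0.
  by rewrite /psi Rplus_0_r; ring.
have -> : 2 * (h * h) = 2 * h * (h - 0) by ring.
apply: (MVT_abs_le _ (fun u => - (s + u) * gauss (s + u) - - s * gauss s)) => // u [u0 uh].
  by rewrite /psi /gauss; auto_derive => //; rewrite /Rdiv; field.
apply: (Rle_trans _ (2 * ((s + u) - s))); last by lra.
apply: (MVT_abs_le (fun u => - u * gauss u) (fun u => (u * u - 1) * gauss u)); first lra.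
  by move=> r _; rewrite /gauss; auto_derive => //; rewrite /Rdiv; field.
move=> r _; have := gauss_weight_le r; have [g0 g1] := gauss_bounds r => w.
rewrite Rabs_mult (Rabs_pos_eq (gauss r)); last lra.
by have : Rabs (r * r - 1) <= 1 + r * r; [apply: Rabs_le; nra | nra].
Qed.

Lemma ex_RInt_gauss (a b : R) : ex_RInt gauss a b.
Proof. exact/ex_RInt_Reals_1/gauss_integrable. Qed.

Lemma gauss_intE (a b : R) : gauss_int a b = RInt gauss a b.
Proof. by rewrite /gauss_int -RInt_Reals. Qed.

Lemma gauss_int_Chasles (a b c : R) : gauss_int a b + gauss_int b c = gauss_int a c.
Proof. by rewrite !gauss_intE; apply: RInt_Chasles; exact: ex_RInt_gauss. Qed.

Lemma gauss_int_point (a : R) : gauss_int a a = 0.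
Proof. by rewrite gauss_intE RInt_point. Qed.

Lemma gauss_int_bounds (a b : R) : a <= b -> 0 <= gauss_int a b <= b - a.
Proof.
move=> ab; rewrite gauss_intE; split.
  apply: RInt_ge_0 => //; first exact: ex_RInt_gauss.
  by move=> s _; have := gauss_bounds s; lra.
have <- : RInt (fun=> 1) a b = b - a by rewrite RInt_const /scal /= /mult /=; ring.
apply: RInt_le => //; [exact: ex_RInt_gauss | exact: ex_RInt_const |].
by move=> s _; have := gauss_bounds s; lra.
Qed.

Lemma gauss_int_step (a h : R) :
  0 <= h -> Rabs (gauss_int a (a + h) - h * gauss a) <= 2 * (h * h).
Proof.
move=> h0; rewrite gauss_intE.
have -> : RInt gauss a (a + h) - h * gauss a = RInt (fun s => gauss s - gauss a) a (a + h).
  rewrite RInt_minus; [|exact: ex_RInt_gauss | exact: ex_RInt_const].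
  by rewrite RInt_const /scal /minus /plus /opp /= /mult /=; ring.
have -> : 2 * (h * h) = (a + h - a) * (2 * h) by ring.
apply: abs_RInt_le_const; first lra.
  by apply: ex_RInt_minus; [exact: ex_RInt_gauss | exact: ex_RInt_const].
move=> s hs; have := gauss_lipschitz a s; lra.
Qed.

(** * Convergence of perturbed Rayleigh chains *)

(* [a m], [b m], [z m] play the roles of P(s > m), P(s = m+1, t = l) for
   [1 <= l <= m], and P(s = m+1, t = 0). *)
Definition near_rayleigh (c delta : R) (N : nat) (a b z : nat -> R) : Prop :=
  a 0%N = 1 /\ forall m : nat, (m < N)%N ->
    [/\ a m - a m.+1 = INR m * b m + z m, 0 <= z m <= delta / c &
        (0 < m)%N -> Rabs (c * c * b m - a m) <= delta].

Lemma Rabs_le4 (p q r s B1 B2 B3 B4 : R) :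
  Rabs p <= B1 -> Rabs q <= B2 -> Rabs r <= B3 -> Rabs s <= B4 ->
  Rabs (p + q + r + s) <= B1 + B2 + B3 + B4.
Proof. by move=> /Rabs_le_between ? /Rabs_le_between ? /Rabs_le_between ? /Rabs_le_between ?;
  apply: Rabs_le; lra. Qed.

Lemma Rabs_mul_le (p q B C : R) : Rabs p <= B -> Rabs q <= C -> Rabs (p * q) <= B * C.
Proof. by move=> pB qC; rewrite Rabs_mult; apply: Rmult_le_compat => //; exact: Rabs_pos. Qed.

(** Error analysis as for an Euler scheme with step [1 / c]: the one-step factor [1 - s * h] lies in
    [0, 1], so errors add up without being amplified. *)
Lemma near_rayleigh_gauss (c delta X : R) (N : nat) (a b z : nat -> R) :
  near_rayleigh c delta N a b z -> 0 < c -> 0 <= delta -> 0 <= X <= c ->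
  INR N <= X * c ->
  forall m : nat, (m <= N)%N ->
    Rabs (a m - gauss (INR m / c)) <=
    INR m * ((X + 1) * (delta / c) + 2 * (1 / c * (1 / c))).
Proof.
move=> [a0 chain] c0 d0 [X0 Xc] NX; elim=> [|m IH] mN.
  rewrite a0 /gauss /= /Rdiv !Rmult_0_l Ropp_0 Rmult_0_l exp_0 Rminus_diag Rabs_R0; lra.
have {chain} [ab [z0 zd] bd] := chain m mN.
have {}IH := IH (ltnW mN).
set e := (_ + _) in IH *.
have mX : INR m <= X * c by apply: Rle_trans NX; apply/le_INR/leP/ltnW.
have m0 := pos_INR m.
have i0 : 0 < 1 / c by apply: Rdiv_lt_0_compat; lra.
set h := 1 / c in i0 e IH *.
have ch : c * h = 1 by rewrite /h; field; lra.
have dh : delta / c = delta * h by rewrite /h; field; lra.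
have mh : INR m / c = INR m * h by rewrite /h; field; lra.
have mh' : INR m.+1 / c = INR m * h + h by rewrite S_INR /h; field; lra.
have mhX : 0 <= INR m * h <= X.
  split; first nra.
  by have -> : X = X * c * h by [rewrite Rmult_assoc ch; lra]; apply: Rmult_le_compat_r; lra.
rewrite mh in IH; rewrite mh' S_INR.
rewrite dh in zd e IH *.
set s := INR m * h in IH mh mh' mhX *.
have tay := gauss_taylor s h (Rlt_le _ _ i0).
have sh : 0 <= s * h <= 1.
  have : s * h <= c * h by apply: Rmult_le_compat_r; lra.
  by split; [nra | lra].
(* Four contributions: the inherited error, the deviation of [b] from [a / c^2], the closing at the
   start, and the Taylor remainder. *)
have t1 : Rabs ((a m - gauss s) * (1 - s * h)) <= INR m * e * 1.
  by apply: Rabs_mul_le => //; apply: Rabs_le; lra.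
have t2 : Rabs (- (s * h * (c * c * b m - a m))) <= X * (delta * h).
  (* At [m = 0] there is no control of [b], but the factor [s] vanishes. *)
  rewrite Rabs_Ropp; case: m mN bd {IH ab z0 zd mX m0 mh mh' tay t1 sh} @s mhX => [|m] mN
    bd s mhX.
    rewrite /s /= !Rmult_0_l Rabs_R0; apply: Rmult_le_pos => //; nra.
  have -> : X * (delta * h) = X * h * delta by ring.
  apply: Rabs_mul_le; last exact: bd.
  by apply: Rabs_le; nra.
have t3 : Rabs (- z m) <= delta * h by rewrite Rabs_Ropp; apply: Rabs_le; lra.
have t4 : Rabs (- (gauss (s + h) - gauss s + h * (s * gauss s))) <= 2 * (h * h).
  by rewrite Rabs_Ropp.
have := Rabs_le4 _ _ _ _ _ _ _ _ t1 t2 t3 t4.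
have -> : (a m - gauss s) * (1 - s * h) + - (s * h * (c * c * b m - a m)) + - z m +
    - (gauss (s + h) - gauss s + h * (s * gauss s)) = a m.+1 - gauss (s + h).
  have -> : s * h * (c * c * b m - a m) = INR m * (c * h) * (c * h) * b m - s * h * a m.
    by rewrite /s; ring.
  rewrite ch; have -> : a m.+1 = a m - INR m * b m - z m by lra.
  ring.
by rewrite /e; lra.
Qed.

(** For [m < T] the minimum is [m], so each summand is [a m - a m.+1] and the sum telescopes. *)
Lemma near_rayleigh_psum (c delta : R) (N : nat) (a b z : nat -> R) (T K : nat) :
  near_rayleigh c delta N a b z -> (K <= N)%N -> (K <= T)%N ->
  psum (fun m => z m + INR (minn T m) * b m) K = 1 - a K.
Proof.
move=> [a0 chain]; elim: K => [|K IH] KN KT; first by rewrite a0 /=; lra.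
have [ab _ _] := chain K KN.
by rewrite psumS (IH (ltnW KN) (ltnW KT)) (minn_idPr (ltnW KT)); lra.
Qed.

(** Up to [T] the sum telescopes. Beyond [T] each summand is close to [T / c] times a term of the
    left Riemann sum of [gauss] with mesh [1 / c], and each step adds a fixed error. *)
Lemma near_rayleigh_psum_tail (c delta X : R) (N : nat) (a b z : nat -> R) (T K : nat) (E :
  R) :
  near_rayleigh c delta N a b z -> 0 < c -> 0 <= delta -> 0 <= X ->
  INR N <= X * c ->
  (forall m : nat, (m <= N)%N -> Rabs (a m - gauss (INR m / c)) <= E) ->
  (T <= K <= N)%N ->
  Rabs (psum (fun m => z m + INR (minn T m) * b m) K -
    (1 - gauss (INR T / c) + INR T / c * gauss_int (INR T / c) (INR K / c))) <=
  E + (INR K - INR T) * (1 / c) * ((1 + X) * delta + X * E + 2 * X * (1 / c)).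
Proof.
move=> ch c0 d0 X0 NX aE /andP[TK].
have E0 : 0 <= E by apply: Rle_trans (Rabs_pos _) (aE 0%N isT).
have i0 : 0 < 1 / c by apply: Rdiv_lt_0_compat; lra.
set h := 1 / c in i0 *.
have cih : c * h = 1 by rewrite /h; field; lra.
have divh r : r / c = r * h by rewrite /h; field; lra.
rewrite -(subnKC TK); elim: (K - T)%N => [|j IH].
  rewrite addn0 => TN; rewrite (near_rayleigh_psum _ _ _ _ _ _ _ _ ch) // gauss_int_point.
  have := aE T TN => /Rabs_le_between aT.
  by apply: Rabs_le; lra.
set k := (T + j)%N in IH *; rewrite addnS -/k => kN.
have Tk : (T <= k)%N by rewrite leq_addr.
have {}IH := IH (ltnW kN).
rewrite psumS (minn_idPl Tk).
have [a0 /(_ k kN)[_ [z0 zd] bd]] := ch.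
rewrite divh in zd.
have T0 := pos_INR T.
have ThX : 0 <= INR T * h <= X.
  split; first nra.
  have -> : X = X * c * h by [rewrite Rmult_assoc cih; lra].
  apply: Rmult_le_compat_r; first lra.
  by apply: Rle_trans NX; apply/le_INR/leP/(leq_trans Tk)/ltnW.
have kS : INR k.+1 / c = INR k / c + h by rewrite S_INR divh divh; ring.
rewrite kS -(gauss_int_Chasles _ (INR k / c)).
set f := (_ + _ + _) in IH *.
have t1 := IH.
have t2 : Rabs (z k) <= delta * h by apply: Rabs_le; lra.
have t3 : Rabs (INR T * h * h * ((c * c * b k - a k) + (a k - gauss (INR k / c)))) <= X * h
  * (delta + E).
  case: (posnP T) => [->|Tp]; first by rewrite /= !Rmult_0_l Rabs_R0; apply: Rmult_le_pos; nra.
  apply: Rabs_mul_le; first by apply: Rabs_le; nra.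
  have /Rabs_le_between := bd (leq_trans Tp Tk); have /Rabs_le_between := aE k (ltnW kN).
  by move=> ? ?; apply: Rabs_le; lra.
have t4 : Rabs (- (INR T * h * (gauss_int (INR k / c) (INR k / c + h) - h * gauss (INR k /
  c)))) <= X * (2 * (h * h)).
  rewrite Rabs_Ropp; apply: Rabs_mul_le; first by apply: Rabs_le; lra.
  by apply: gauss_int_step; lra.
have := Rabs_le4 _ _ _ _ _ _ _ _ t1 t2 t3 t4.
set G1 := gauss_int _ _; set G2 := gauss_int _ _; set P := psum _ _.
rewrite (divh (INR T)).
have -> : INR T * h * h * (c * c * b k - a k + (a k - gauss (INR k / c))) =
  INR T * (c * h) * (c * h) * b k - INR T * h * h * gauss (INR k / c) by ring.
rewrite cih.
set L := Rabs _ => H; set L' := Rabs _.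
have -> : L' = L by rewrite /L /L'; congr Rabs; ring.
apply: Rle_trans H _; rewrite S_INR /f; right; ring.
Qed.

Lemma gauss0 : gauss 0 = 1.
Proof. by rewrite /gauss Rmult_0_l Ropp_0 /Rdiv Rmult_0_l exp_0. Qed.

(** The limit distribution function at the grid point [(K / c, T / c)], with its case split made on
    integers to match the two regimes of the partial sums. *)
Definition grid_cdf (c : R) (T K : nat) : R :=
  if (K <= T)%N then 1 - gauss (INR K / c)
  else 1 - gauss (INR T / c) + INR T / c * gauss_int (INR T / c) (INR K / c).

Lemma grid_cdf_close (c x y : R) (T K : nat) :
  0 < c -> 0 < x -> 0 <= y -> INR K <= x * c < INR K + 1 ->
  INR T <= y * c < INR T + 1 ->
  Rabs (grid_cdf c T K - rayleighU_cdf x y) <= (2 + 2 * x) * (1 / c).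
Proof.
move=> c0 x0 y0.
have i0 : 0 < 1 / c by apply: Rdiv_lt_0_compat; lra.
set h := 1 / c in i0 *.
have cih : c * h = 1 by rewrite /h; field; lra.
have divh r : r / c = r * h by rewrite /h; field; lra.
have unit_h r s : r <= s * c < r + 1 -> r * h <= s < r * h + h.
  move=> [r1 r2]; have -> : s = s * c * h by rewrite Rmult_assoc cih; lra.
  by split; nra.
move=> /unit_h kx /unit_h ty.
have K0 := pos_INR K; have T0 := pos_INR T.
rewrite /grid_cdf /rayleighU_cdf !divh -/(gauss x) -/(gauss y).
set k := INR K * h in kx *; set t := INR T * h in ty *.
have k0 : 0 <= k by rewrite /k; nra.
have t0 : 0 <= t by rewrite /t; nra.
have gl p q : p <= q -> 0 <= q - p <= h -> Rabs (gauss q - gauss p) <= 2 * h.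
  by move=> pq qp; apply: Rle_trans (gauss_lipschitz p q pq) _; lra.
have xh : 0 <= x * h by nra.
destruct (Rle_dec x 0) as [x0'|nx]; first lra.
rewrite /=; case KT : (K <= T)%N.
  have kt : k <= t by apply: Rmult_le_compat_r; [lra | apply/le_INR/leP].
  destruct (Rle_dec y 0) as [y0'|yp]; rewrite /=.
    have -> : k = 0 by lra.
    by rewrite gauss0; apply: Rabs_le; lra.
  destruct (Rle_dec x y) as [xy|yx]; rewrite /=.
    have /Rabs_le_between gk : Rabs (gauss x - gauss k) <= 2 * h by apply: gl; lra.
    by apply: Rabs_le; lra.
  (* Rounding may reverse the order: [K <= T] although [y < x]. Then [x - y] is less than the mesh,
     and the integral term is negligible. *)
  have /Rabs_le_between gk : Rabs (gauss y - gauss k) <= 2 * h by apply: gl; lra.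
  have [G0 G1] : 0 <= gauss_int y x <= x - y by apply: gauss_int_bounds; lra.
  have : 0 <= y * gauss_int y x <= x * h.
    by split; [apply: Rmult_le_pos | apply: Rmult_le_compat; lra].
  by move=> ?; apply: Rabs_le; lra.
have {}KT : (T < K)%N by rewrite ltnNge KT.
(* Conversely, [T < K] forces [y < t + h <= k <= x], so the case [x <= y] cannot occur. *)
have tk : t + h <= k.
  have -> : t + h = INR T.+1 * h by rewrite S_INR /t; ring.
  by apply: Rmult_le_compat_r; [lra | apply/le_INR/leP].
have /Rabs_le_between gk : Rabs (gauss y - gauss t) <= 2 * h by apply: gl; lra.
have [G0 G1] : 0 <= gauss_int t k <= k - t by apply: gauss_int_bounds; lra.
have [H0 H1] : 0 <= gauss_int t y <= y - t by apply: gauss_int_bounds; lra.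
have [I0 I1] : 0 <= gauss_int k x <= x - k by apply: gauss_int_bounds; lra.
have Ch : gauss_int t y + gauss_int y x = gauss_int t k + gauss_int k x.
  by rewrite !gauss_int_Chasles.
have bd : Rabs (t * gauss_int t k - y * gauss_int y x) <= 2 * x * h.
  (* By Chasles, the two integrals differ only on the short intervals from [t] to [y] and from [k]
     to [x]. *)
  have -> : t * gauss_int t k - y * gauss_int y x =
    (t - y) * gauss_int t k + y * (gauss_int t y - gauss_int k x).
    have -> : gauss_int y x = gauss_int t k + gauss_int k x - gauss_int t y by lra.
    ring.
  have A1 : Rabs ((t - y) * gauss_int t k) <= h * x.
    by apply: Rabs_mul_le; apply: Rabs_le; lra.
  have A2 : Rabs (y * (gauss_int t y - gauss_int k x)) <= x * h.
    by apply: Rabs_mul_le; apply: Rabs_le; lra.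
  by move: A1 A2 => /Rabs_le_between ? /Rabs_le_between ?; apply: Rabs_le; lra.
move: bd => /Rabs_le_between bd.
destruct (Rle_dec y 0) as [y0'|yp]; rewrite /=.
  have e : y = 0 by lra.
  rewrite e gauss0 in gk; rewrite e Rmult_0_l in bd.
  by apply: Rabs_le; lra.
destruct (Rle_dec x y) as [xy|yx]; rewrite /=; first lra.
by apply: Rabs_le; lra.
Qed.

(** The three summands account for the error of the chain, that of the Riemann sum and that of
    rounding [x] and [y] to the grid. *)
Definition rate_const (x : R) : R :=
  let e := x * (x + 3) in e + x * (1 + x + x * e + 2 * x) + (2 + 2 * x).

Lemma near_rayleigh_cdf (c delta x y : R) (a b z : nat -> R) (T K : nat) :
  near_rayleigh c delta K a b z -> 0 < c -> 0 <= delta -> 0 < x <= c -> 0 <= y ->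
  INR K <= x * c < INR K + 1 -> INR T <= y * c < INR T + 1 ->
  Rabs (psum (fun m => z m + INR (minn T m) * b m) K - rayleighU_cdf x y) <=
  rate_const x * (delta + 1 / c).
Proof.
move=> ch c0 d0 [x0 xc] y0 Kx Ty.
have i0 : 0 < 1 / c by apply: Rdiv_lt_0_compat; lra.
have cdf := grid_cdf_close c x y T K c0 x0 y0 Kx Ty.
set h := 1 / c in i0 cdf *.
have cih : c * h = 1 by rewrite /h; field; lra.
have divh r : r / c = r * h by rewrite /h; field; lra.
have x0c : 0 <= x <= c by lra.
set e := x * (x + 3) * (delta + h).
have aE m : (m <= K)%N -> Rabs (a m - gauss (INR m / c)) <= e.
  move=> mK; apply: Rle_trans (near_rayleigh_gauss c delta x K a b z ch c0 d0 x0c (proj1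
    Kx) m mK) _.
  rewrite -/h divh; apply: (Rle_trans _ (x * c * ((x + 1) * (delta * h) + 2 * (h * h)))).
    apply: Rmult_le_compat_r; first by have := Rmult_le_pos _ _ d0 (Rlt_le _ _ i0); nra.
    by apply: Rle_trans (proj1 Kx); apply/le_INR/leP.
  have -> : x * c * ((x + 1) * (delta * h) + 2 * (h * h)) =
    x * ((x + 1) * (delta * (c * h)) + 2 * (c * h * h)) by ring.
  rewrite cih /e Rmult_assoc; apply: Rmult_le_compat_l; first lra.
  by have := Rmult_le_pos _ _ (Rlt_le _ _ x0) (Rlt_le _ _ i0); lra.
have e0 : 0 <= e by apply: Rle_trans (Rabs_pos _) (aE 0%N isT).
have main : Rabs (psum (fun m => z m + INR (minn T m) * b m) K - grid_cdf c T K) <=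
    e + x * ((1 + x) * delta + x * e + 2 * x * h).
  have F0 : 0 <= (1 + x) * delta + x * e + 2 * x * h.
    have := Rmult_le_pos _ _ (Rlt_le _ _ x0) (Rlt_le _ _ i0).
    have := Rmult_le_pos _ _ (Rlt_le _ _ x0) d0.
    by have := Rmult_le_pos _ _ (Rlt_le _ _ x0) e0; lra.
  have xF := Rmult_le_pos _ _ (Rlt_le _ _ x0) F0.
  rewrite /grid_cdf; case KT : (K <= T)%N.
    rewrite (near_rayleigh_psum _ _ _ _ _ _ _ _ ch) //.
    have := aE K (leqnn K) => /Rabs_le_between ?.
    by apply: Rabs_le; lra.
  have TK : (T <= K <= K)%N by rewrite leqnn andbT ltnW // ltnNge KT.
  apply: Rle_trans (near_rayleigh_psum_tail c delta x K a b z T K e ch c0 d0 (Rlt_le _ _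
    x0) (proj1 Kx) aE TK) _.
  rewrite -/h; apply/Rplus_le_compat_l/Rmult_le_compat_r => //.
  have -> : x = x * c * h by rewrite Rmult_assoc cih; lra.
  by apply: Rmult_le_compat_r; have := pos_INR T; lra.
move: main cdf => /Rabs_le_between main /Rabs_le_between cdf.
have bound : e + x * ((1 + x) * delta + x * e + 2 * x * h) + (2 + 2 * x) * h <=
    rate_const x * (delta + h).
  have hx := Rmult_le_pos _ _ (Rlt_le _ _ x0) (Rlt_le _ _ i0).
  have dx := Rmult_le_pos _ _ (Rlt_le _ _ x0) d0.
  have dxx := Rmult_le_pos _ _ (Rlt_le _ _ x0) dx.
  have hxx := Rmult_le_pos _ _ (Rlt_le _ _ x0) hx.
  by rewrite /rate_const /e; lra.
by apply: Rabs_le; lra.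
Qed.

(** As [maxdeg >= 1], the hypothesis on [theta] makes [m], [m.+1 * maxdeg] and [maxdeg * c] all at
    most [theta * n], so the bounds on [rho_prob] and [cycle_prob] have relative errors of order
    [theta]. *)
Lemma near_rayleigh_probs (n : nat) (d : nat -> nat) (v : 'I_n) (c X theta : R) (K : nat) :
  is_degree_seq n d -> 0 < c -> c * c * sigma2 n d = INR n ->
  0 <= X -> 1 <= c -> theta <= 1 / 4 ->
  (X + 1) * (INR (maxdeg n d) * c) <= theta * INR n -> INR K <= X * c ->
  near_rayleigh c (4 * theta) K (simple_prob n d v) (rho_prob n d v) (cycle_prob n d v).
Proof.
move=> dn c0 cs X0 c1 th4 Dc KX; split; first exact: simple_prob0.
move=> m mK.
have n0 : (0 < n)%N by case: n v {dn cs Dc} => // -[].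
have N0 : 0 < INR n by apply/lt_0_INR/ltP.
have D1 : 1 <= INR (maxdeg n d) by apply: (le_INR 1); apply/leP; exact: maxdeg_gt0.
set D := INR (maxdeg n d) in D1 Dc *; set N := INR n in N0 cs Dc *.
have mX : INR m.+1 <= X * c by apply: Rle_trans KX; apply/le_INR/leP.
have mD : INR m.+1 * D <= theta * N.
  apply: Rle_trans Dc; have -> : (X + 1) * (D * c) = X * c * D + D * c by ring.
  have : INR m.+1 * D <= X * c * D by apply: Rmult_le_compat_r; lra.
  by nra.
have DcN : D * c <= theta * N.
  by apply: Rle_trans Dc; have := Rmult_le_pos D c; nra.
have m0 := pos_INR m.
rewrite S_INR in mX mD.
have mN' : INR m <= theta * N by nra.
have th0 : 0 < theta.
  have : 0 < theta * N by nra.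
  by move=> H; apply: (Rmult_lt_reg_r N) => //; lra.
have mN : (m < n)%N by apply/ltP/INR_lt; rewrite -/N; nra.
have [a0 a1] : 0 <= simple_prob n d v m <= 1.
  by split; [apply: simple_prob_ge0 | apply: simple_prob_le1] => //; exact: ltnW.
have dv : 0 <= INR (d v) <= D by split; [exact: pos_INR | apply/le_INR/leP;
  exact: deg_le_maxdeg].
split; first exact: simple_prob_succ.
- have := cycle_prob_mul n d v m mN; rewrite -/N.
  set zz := cycle_prob _ _ _ _; set aa := simple_prob _ _ _ _ in a0 a1 * => ze.
  have nm : 3 / 4 * N <= N - INR m by nra.
  have z0 : 0 <= zz by apply: (Rmult_le_reg_r (N - INR m)); [lra | rewrite ze; nra].
  split=> //.
  have zD : zz * (N - INR m) <= D by rewrite ze; nra.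
  have zN : zz * (3 / 4 * N) <= D by nra.
  apply: (Rmult_le_reg_r c) => //; have -> : 4 * theta / c * c = 4 * theta by field; lra.
  apply: (Rmult_le_reg_r N) => //.
  have : zz * (3 / 4 * N) * c <= D * c by apply: Rmult_le_compat_r; lra.
  have : 0 <= zz * c * N by apply: Rmult_le_pos; [apply: Rmult_le_pos |]; lra.
  by nra.
move=> m1; have m1N : (0 < m < n)%N by rewrite m1.
have := rho_prob_ge n d v m dn m1N; have := rho_prob_le n d v m dn m1N.
have := rho_prob_ge0 n d v m mN.
rewrite -/N -/D S_INR.
set bb := rho_prob _ _ _ _; set aa := simple_prob _ _ _ _ in a0 a1 *;
  set s := sigma2 n d in cs *.
move=> b0 le ge.
(* Both factors in [rho_prob_le] are at least [(1 - theta) * n], and [c * c * sigma2 = n] removes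
   the variance. *)
have up : (1 - theta) * (1 - theta) * (c * c * bb) <= aa.
  apply: (Rmult_le_reg_r (N * N)); first nra.
  have -> : aa * (N * N) = c * c * (N * s * aa) by rewrite -{2}cs; ring.
  have -> : (1 - theta) * (1 - theta) * (c * c * bb) * (N * N) =
    c * c * (((1 - theta) * N) * ((1 - theta) * N) * bb) by ring.
  apply: Rmult_le_compat_l; first nra.
  apply: Rle_trans le; apply: Rmult_le_compat_r => //.
  by apply: Rmult_le_compat; nra.
(* The loss due to [d v] is at most [theta^2], because [d v * c <= theta * n]. *)
have low : (1 - theta * theta) * aa <= (1 + theta) * (c * c * bb).
  apply: (Rmult_le_reg_r (N * N)); first nra.
  apply: (Rle_trans _ (c * c * ((N * s - INR (d v) * INR (d v)) * aa))).
    have -> : c * c * ((N * s - INR (d v) * INR (d v)) * aa) =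
      (N * (c * c * s) - (INR (d v) * c) * (INR (d v) * c)) * aa by ring.
    rewrite cs.
    have : (INR (d v) * c) * (INR (d v) * c) <= (theta * N) * (theta * N).
      have : INR (d v) * c <= D * c by apply: Rmult_le_compat_r; lra.
      have : 0 <= INR (d v) * c by apply: Rmult_le_pos; lra.
      by move=> ? ?; apply: Rmult_le_compat; lra.
    set q := _ * _ * (_ * _) => Hq.
    have -> : (1 - theta * theta) * aa * (N * N) = (N * N - theta * N * (theta * N)) * aa
      by ring.
    by apply: Rmult_le_compat_r; lra.
  have -> : (1 + theta) * (c * c * bb) * (N * N) = c * c * ((1 + theta) * N * N * bb) by ring.
  apply: Rmult_le_compat_l; first nra.
  apply: Rle_trans ge _; apply: Rmult_le_compat_r => //.
  by apply: Rmult_le_compat; nra.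
set w := c * c * bb in up low *.
have w0 : 0 <= w by apply: Rmult_le_pos => //; nra.
have low' : (1 - theta) * aa <= w by apply: (Rmult_le_reg_l (1 + theta)); nra.
have up' : w <= (1 + 4 * theta) * aa.
  (* The product equals [1 + theta * (2 - 7 * theta + 4 * theta^2)], and the bracket is positive for
     [theta <= 1 / 4]. *)
  have k1 : 1 <= (1 + 4 * theta) * ((1 - theta) * (1 - theta)) by nra.
  have : (1 + 4 * theta) * ((1 - theta) * (1 - theta) * w) <= (1 + 4 * theta) * aa.
    by apply: Rmult_le_compat_l; lra.
  by have : 1 * w <= (1 + 4 * theta) * ((1 - theta) * (1 - theta)) * w;
    [apply: Rmult_le_compat_r | lra].
by apply: Rabs_le; nra.
Qed.

(** * The limit theorem *)

Lemma RlebP (p q : R) : reflect (p <= q) (Rleb p q).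
Proof. by rewrite /Rleb; case: (Rle_dec p q) => H /=; constructor. Qed.

Lemma Rleb_floor (c x : R) (k K : nat) :
  0 < c -> INR K <= x * c < INR K + 1 -> Rleb (INR k / c) x = (k <= K)%N.
Proof.
move=> c0 [K1 K2]; have e : INR k = INR k / c * c by field; lra.
apply/RlebP/idP => [kx|kK].
  rewrite -ltnS; apply/ltP/INR_lt; rewrite S_INR.
  by apply: Rle_lt_trans K2; rewrite e; apply: Rmult_le_compat_r; lra.
apply: (Rmult_le_reg_r c) => //; rewrite -e; apply: Rle_trans K1.
exact/le_INR/leP.
Qed.

Lemma psum_ext (u w : nat -> R) (k : nat) :
  (forall m : nat, u m = w m) -> psum u k = psum w k.
Proof. by move=> uw; elim: k => //= k ->; rewrite uw. Qed.

Lemma joint_cdf_psum (n : nat) (d : nat -> nat) (v : 'I_n) (x y c : R) (K T : nat) :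
  is_degree_seq n d -> c = sqrt (INR n / sigma2 n d) -> 0 < c ->
  INR K <= x * c < INR K + 1 -> INR T <= y * c < INR T + 1 -> (K <= n)%N ->
  joint_cdf_n n d v x y =
  psum (fun m => cycle_prob n d v m + INR (minn T m) * rho_prob n d v m) K.
Proof.
move=> dn cE c0 Kx Ty Kn; rewrite /joint_cdf_n -cE.
rewrite [LHS](_ : _ = INR #|[set f in fibers n d |
    (six_len n (natf f) v <= K)%N && (tail_len n (natf f) v <= T)%N]|
    / INR #|fibers n d|); last first.
  congr (INR _ / _); apply: eq_card => f.
  by rewrite !in_set (Rleb_floor c x _ K) // (Rleb_floor c y _ T).
rewrite card_joint_fraction //; apply: psum_ext => m.
by rewrite /cycle_prob /rho_prob /Rdiv; ring.
Qed.

(** The six-length is at least 1, which covers [x = 0]; the tail-length can be 0, so [y = 0] is left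
    to the main argument. *)
Lemma joint_cdf_npos (n : nat) (d : nat -> nat) (v : nat) (x y : R) :
  0 < sqrt (INR n / sigma2 n d) -> x <= 0 \/ y < 0 -> joint_cdf_n n d v x y = 0.
Proof.
move=> c0 xy; rewrite /joint_cdf_n eq_card0 ?Rdiv_0_l // => f.
rewrite in_set; apply/negP => /and3P[_ /RlebP sx /RlebP ty].
have ic := Rinv_0_lt_compat _ c0.
case: xy => [x0|y0].
  have : 0 < INR (six_len n (natf f) v) / sqrt (INR n / sigma2 n d).
    by apply: Rmult_lt_0_compat => //; apply/lt_0_INR/ltP.
  lra.
have : 0 <= INR (tail_len n (natf f) v) / sqrt (INR n / sigma2 n d).
  by apply: Rmult_le_pos; [exact: pos_INR | lra].
lra.
Qed.

Lemma sigma2_ge0 (n : nat) (d : nat -> nat) :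
  (0 < n)%N -> is_degree_seq n d -> 0 <= sigma2 n d.
Proof.
move=> n0 dn; have N0 : 0 < INR n by apply/lt_0_INR/ltP.
have : INR n <= INR (m2 n d).
  apply/le_INR/leP; rewrite -[X in (X <= _)%N]dn; apply: leq_sum => i _.
  by case: (d i) => // k; rewrite leq_pmulr.
move=> H; rewrite /sigma2; apply: (Rmult_le_reg_r (INR n)) => //.
by rewrite Rmult_0_l; have -> : (INR (m2 n d) / INR n - 1) * INR n = INR (m2 n d) - INR n;
  [field | ]; lra.
Qed.

(* Only these consequences of the growth conditions matter: the logarithms are dropped. *)
Lemma scaling_small (d : nat -> nat -> nat)
  (Hdeg : forall n : nat, (1 <= n)%N -> is_degree_seq n (d n))
  (Hs_up : little_o (fun n => sigma2 n (d n)) (fun n => INR n / (ln (INR n)) ^ 3))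
  (Hs_low : little_o (fun n => / INR n) (fun n => sigma2 n (d n)))
  (HDelta : little_o (fun n => INR (maxdeg n (d n)))
                     (fun n => sqrt (INR n * sigma2 n (d n) / (ln (INR n)) ^ 3)))
  (eps : R) : 0 < eps ->
  exists N0 : nat, forall n : nat, (N0 <= n)%N ->
    let c := sqrt (INR n / sigma2 n (d n)) in
    [/\ (0 < n)%N, 0 < c, c * c * sigma2 n (d n) = INR n, 1 / c <= eps &
        INR (maxdeg n (d n)) * c <= eps * INR n].
Proof.
move=> e0.
have [N1 H1] := Hs_low 1 Rlt_0_1.
(* The square appears because [1 / c] is the square root of [sigma2 / n]. *)
have [N2 H2] := Hs_up (eps * eps) (Rmult_lt_0_compat _ _ e0 e0).
have [N3 H3] := HDelta eps e0.
(* From [n = 3] on, [ln n >= 1], so dividing by its cube only decreases the bounds. *)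
exists (maxn 3 (maxn N1 (maxn N2 N3))) => n; rewrite !geq_max => /and4P[n3 n1 n2 n4] c.
have n0 : (0 < n)%N by apply: leq_trans n3.
have dn := Hdeg n n0; have s_ge0 := sigma2_ge0 n (d n) n0 dn.
have nR : 3 <= INR n by have := le_INR _ _ (elimT leP n3); rewrite /=; lra.
have {}H1 := H1 n n1; have {}H2 := H2 n n2; have {}H3 := H3 n n4.
set s := sigma2 n (d n) in c s_ge0 H1 H2 H3 *; set N := INR n in nR c H1 H2 H3 *.
have s0 : 0 < s.
  have iN : 0 < / N by apply: Rinv_0_lt_compat; lra.
  by rewrite !Rabs_pos_eq in H1; lra.
have L1 : 1 <= ln N.
  rewrite -(ln_exp 1); apply: ln_le; first exact: exp_pos.
  by have := exp_le_3; lra.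
have L3 : 1 <= ln N ^ 3 by apply: pow_R1_Rle.
have iL : 0 < / ln N ^ 3 <= 1.
  split; first by apply: Rinv_0_lt_compat; lra.
  by rewrite -Rinv_1; apply: Rinv_le_contravar; lra.
have Ns : 0 < N / s by apply: Rdiv_lt_0_compat; lra.
have c0 : 0 < c by exact: sqrt_lt_R0.
have cc : c * c = N / s by rewrite sqrt_sqrt //; lra.
have ccs : c * c * s = N by rewrite cc; field; lra.
split=> //.
- have {}H2 : s <= eps * eps * N.
    move: H2; rewrite !Rabs_pos_eq; [|by rewrite /Rdiv; nra | lra].
    move=> H2; apply: Rle_trans H2 _; apply: Rmult_le_compat_l; first nra.
    by rewrite /Rdiv; nra.
  apply: (Rmult_le_reg_r c) => //.
  have -> : 1 / c * c = 1 by field; lra.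
  have : 1 <= (eps * c) * (eps * c).
    apply: (Rmult_le_reg_r s) => //.
    by have -> : eps * c * (eps * c) * s = eps * eps * (c * c * s) by [ring]; rewrite ccs; lra.
  by have := Rmult_lt_0_compat _ _ e0 c0; nra.
have {}H3 : INR (maxdeg n (d n)) <= eps * sqrt (N * s).
  move: H3; rewrite !Rabs_pos_eq; [|exact: sqrt_pos | exact: pos_INR].
  move=> H3; apply: Rle_trans H3 _; apply: Rmult_le_compat_l; first lra.
  have : 0 < N * s by nra.
  by move=> ?; apply: sqrt_le_1_alt; rewrite /Rdiv; nra.
apply: (Rle_trans _ (eps * sqrt (N * s) * c)); first by apply: Rmult_le_compat_r; lra.
rewrite Rmult_assoc /c -sqrt_mult; [|nra|lra].
have -> : N * s * (N / s) = N * N by field; lra.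
by rewrite sqrt_square; lra.
Qed.

Theorem theorem2p3 (d : nat -> nat -> nat) (v : nat -> nat)
  (Hdeg : forall n : nat, (1 <= n)%nat -> is_degree_seq n (d n))
  (Hv : forall n : nat, (1 <= n)%nat -> (v n < n)%nat)
  (Hs_up : little_o (fun n => sigma2 n (d n)) (fun n => INR n / (ln (INR n)) ^ 3))
  (Hs_low : little_o (fun n => / INR n) (fun n => sigma2 n (d n)))
  (HDelta : little_o (fun n => INR (maxdeg n (d n)))
                     (fun n => sqrt (INR n * sigma2 n (d n) / (ln (INR n)) ^ 3))) :
  forall x y : R,
    Un_cv (fun n => joint_cdf_n n (d n) (v n) x y) (rayleighU_cdf x y).
Proof.
move=> x y.
have small := scaling_small d Hdeg Hs_up Hs_low HDelta.
have [npos|[x0 y0]] : (x <= 0 \/ y < 0) \/ (0 < x /\ 0 <= y) by lra.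
  have -> : rayleighU_cdf x y = 0.
    rewrite /rayleighU_cdf; case: (Rle_dec x 0) => //= x0.
    by case: (Rle_dec y 0) => //= y0; lra.
  move=> e e0; have [N0 H] := small 1 Rlt_0_1.
  exists N0 => n /leP /H [n0 c0 _ _ _].
  by rewrite joint_cdf_npos // /Rdist Rminus_diag Rabs_R0.
move=> e e0.
have C0 : 0 < rate_const x.
  have xx : 0 < x * (x + 3) by apply: Rmult_lt_0_compat; lra.
  have xe : 0 < x * (x * (x + 3)) by apply: Rmult_lt_0_compat; lra.
  by have xf : 0 < x * (1 + x + x * (x * (x + 3)) + 2 * x) by [apply: Rmult_lt_0_compat; lra];
    rewrite /rate_const; lra.
(* With [theta = (x + 1) * eps], the total [delta + 1 / c] is at most
   [4 * theta + eps = B * eps]. *)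
set B := (x + 1) * 4 + 1.
have B0 : 0 < B by rewrite /B; lra.
(* The first bound yields [theta <= 1 / 4] and [B <= c]; the second makes the final error at most
   [e / 2]. *)
set eps := Rmin (1 / B) (e / (2 * (rate_const x * B))).
have CB := Rmult_lt_0_compat _ _ C0 B0.
have eps0 : 0 < eps.
  by apply: Rmin_glb_lt; apply: Rdiv_lt_0_compat; lra.
have epsB : eps * B <= 1.
  have : eps <= 1 / B by exact: Rmin_l.
  move/(Rmult_le_compat_r B _ _ (Rlt_le _ _ B0)).
  by have -> : 1 / B * B = 1 by field; lra.
have epsC : eps * (rate_const x * B) < e.
  have : eps <= e / (2 * (rate_const x * B)) by exact: Rmin_r.
  move/(Rmult_le_compat_r (rate_const x * B) _ _ (Rlt_le _ _ CB)).
  have -> : e / (2 * (rate_const x * B)) * (rate_const x * B) = e / 2 by field; lra.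
  lra.
have [N0 H] := small eps eps0.
exists N0 => n /leP /H; set c := sqrt _ => -[n0 c0 ccs ic Dc] {H}.
have dn := Hdeg n n0.
have cB : B <= c.
  have : 1 / c * (c * B) <= eps * (c * B).
    by apply: Rmult_le_compat_r => //; apply: Rmult_le_pos; lra.
  have -> : 1 / c * (c * B) = B by field; lra.
  have -> : eps * (c * B) = c * (eps * B) by ring.
  by nra.
have xc0 : 0 <= x * c by apply: Rmult_le_pos; lra.
have yc0 : 0 <= y * c by apply: Rmult_le_pos; lra.
have [K Kx] := nfloor_ex (x * c) xc0.
have [T Ty] := nfloor_ex (y * c) yc0.
have nR : 0 < INR n by apply/lt_0_INR/ltP.
have D1 : 1 <= INR (maxdeg n (d n)).
  by apply: (le_INR 1); apply/leP; exact: maxdeg_gt0.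
have th : (x + 1) * eps <= 1 / 4 by rewrite /B in epsB; lra.
have Dc' : (x + 1) * (INR (maxdeg n (d n)) * c) <= (x + 1) * eps * INR n.
  by rewrite Rmult_assoc; apply: Rmult_le_compat_l; lra.
(* Indeed [K <= x * c <= (x + 1) * maxdeg * c <= n / 4]. *)
have Kn : (K <= n)%N.
  apply/leP/INR_le.
  have : c <= INR (maxdeg n (d n)) * c by nra.
  by nra.
pose w : 'I_n := Ordinal (Hv n n0).
have NR : near_rayleigh c (4 * ((x + 1) * eps)) K (simple_prob n (d n) w)
    (rho_prob n (d n) w) (cycle_prob n (d n) w).
  by apply: (near_rayleigh_probs n (d n) w c x ((x + 1) * eps) K) => //; rewrite /B in cB; lra.
have xc : 0 < x <= c by rewrite /B in cB; lra.
have d0 : 0 <= 4 * ((x + 1) * eps) by have := Rmult_lt_0_compat (x + 1) eps; lra.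
have := near_rayleigh_cdf c _ x y _ _ _ T K NR c0 d0 xc y0 Kx Ty.
rewrite -(joint_cdf_psum n (d n) w x y c K T dn erefl c0 Kx Ty Kn) /Rdist.
move=> bd; apply: (Rle_lt_trans _ _ _ bd); apply: Rle_lt_trans epsC.
have -> : eps * (rate_const x * B) = rate_const x * (4 * ((x + 1) * eps) + eps) by rewrite /B;
  ring.
by apply: Rmult_le_compat_l; lra.
Qed.
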